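(* Let $0<\alpha<1$. Let $X,X_1,X_2,\ldots$ be i.i.d. non-negative random variables with mean $\nu$ and with moment-generating function $M_X(\vartheta)=\mathbb{E}[e^{\vartheta X}]$ finite for all $\vartheta$ in an open set containing $0$. Let $a>\nu$, assume $b_+:=\sup\{b:\mathbb{P}(X>b)>0\}\geqslant a$, and assume that there is a (unique) solution $\vartheta_a$, in the interior of $\{\vartheta:M_X(\vartheta)<\infty\}$, of $M_X'(\vartheta)/M_X(\vartheta)=a$. Let $\mathbb{P}_a$ (with expectation $\mathbb{E}_a$) be the probability measure under which $X_1,X_2,\ldots$ are i.i.d. with the exponentially twisted distribution $\mathbb{P}_a(X\in dx)=\frac{e^{\vartheta_ax}}{M_X(\vartheta_a)}\mathbb{P}(X\in dx)$, so that $\mathbb{E}_a[X]=a$. For $\vec X=(X_1,\ldots,X_{N^\alpha})$ let $$L(\vec X):=\prod_{j=1}^{N^\alpha}M_X(\vartheta_a)\,e^{-\vartheta_aX_j}.$$ Then the importance sampling estimator $\hat P_N^{(n)}(a)$ (defined in the context) is asymptotically efficient for estimating $P_N(a):=\mathbb{P}(\mathrm{Pois}(N\overline{X}_{N^\alpha})\geqslant Na)$; that is, $$\limsup_{N\to\infty}\frac{1}{N^\alpha}\log\mathbb{E}_a\left[\left(L(\vec X)\,\mathbf{1}\left\{\mathrm{Pois}\left(N\overline{X}_{N^\alpha}\right)\geqslant Na\right\}\right)^2\right]\leqslant-2\,I_X(a),$$ where $I_X(a):=\sup_{\vartheta\in\mathbb{R}}\{\vartheta a-\log M_X(\vartheta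)\}$.
   Context: For a positive integer $m$, $\overline{X}_m:=\frac1m\sum_{i=1}^mX_i$. For a non-negative random variable $Y$, $\mathrm{Pois}(Y)$ denotes a mixed Poisson random variable: conditionally on $Y=y$ it is Poisson with mean $y$ (also under $\mathbb{P}_a$). The estimator based on $n$ runs is $$\hat P_N^{(n)}(a)=\frac1n\sum_{i=1}^nL(\vec X^{(i)})\,\mathbf{1}\left\{\mathrm{Pois}(NY_i)\geqslant Na\right\},$$ where $\vec X^{(1)},\ldots,\vec X^{(n)}$ are independent samples of $(X_1,\ldots,X_{N^\alpha})$ under $\mathbb{P}_a$, $Y_i$ is the sample mean of the entries of $\vec X^{(i)}$, and $L$ is the likelihood ratio of the original measure with respect to $\mathbb{P}_a$. Asymptotic efficiency means precisely the displayed $\limsup$ inequality. The limit in $N$ is along values for which $Na$ and $N^\alpha$ are positive integers. *)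

(* Defs.v *)
From mathcomp Require Import all_boot all_order all_algebra.
From mathcomp Require Import all_classical all_reals all_analysis.

Set Implicit Arguments.
Unset Strict Implicit.
Unset Printing Implicit Defensive.

Import Order.TTheory GRing.Theory Num.Theory.
Import numFieldNormedType.Exports.

Local Open Scope classical_set_scope.
Local Open Scope ring_scope.
Local Open Scope ereal_scope.

Definition mutually_independent (d : measure_display) (T : measurableType d)
    (R : realType) (P : probability T R) (X : nat -> {mfun T >-> R}) : Prop :=
  forall (s : seq nat) (B : nat -> set R),
    uniq s -> (forall i, measurable (B i)) ->
    P (\bigcap_(i in [set` s]) (X i @^-1` B i)) =
    \prod_(i <- s) P (X i @^-1` B i).

(* Laws are compared on measurable sets only: the value of a library measure
   on a non-measurable set is meaningless. *)
Definition iid_with_law (d : measure_display) (T : measurableType d)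
    (R : realType) (P : probability T R) (X : nat -> {mfun T >-> R})
    (law : set R -> \bar R) : Prop :=
  mutually_independent P X /\
  forall (i : nat) (B : set R), measurable B -> P (X i @^-1` B) = law B.

Definition mgf_domain (d : measure_display) (T : measurableType d)
    (R : realType) (P : probability T R) (X : T -> R) : set R :=
  [set t | 'M_P X t < +oo].

(* Real-valued; only meaningful on [mgf_domain]. *)
Definition mgf (d : measure_display) (T : measurableType d)
    (R : realType) (P : probability T R) (X : T -> R) (t : R) : R :=
  fine ('M_P X t).

Definition twisted_law (d : measure_display) (T : measurableType d)
    (R : realType) (P : probability T R) (X : {mfun T >-> R}) (theta : R)
    (B : set R) : \bar R :=
  \int[distribution P X]_(x in B) (expR (theta * x) / mgf P X theta)%:E.

(* sup {b : P(X > b) > 0} *)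
Definition right_endpoint (d : measure_display) (T : measurableType d)
    (R : realType) (P : probability T R) (X : T -> R) : \bar R :=
  ereal_sup [set b%:E | b in [set b : R | 0 < P [set w | (b < X w)%R]]].

(* [lne +oo = +oo], so the parameters outside [mgf_domain] contribute -oo. *)
Definition rate_function (d : measure_display) (T : measurableType d)
    (R : realType) (P : probability T R) (X : T -> R) (a : R) : \bar R :=
  ereal_sup (range (fun t : R => (t * a)%:E - lne ('M_P X t))).

(* Given Y, the conditional law of Z is Poisson with mean Y.  The measure
   [poisson_prob r _] is the Dirac mass at 0 when r = 0 (whereas [poisson_pmf]
   is not a mass function there); its nat argument is a dummy. *)
Definition mixed_poisson (d : measure_display) (T : measurableType d)
    (R : realType) (P : probability T R) (Y : T -> R) (Z : T -> nat) : Prop :=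
  forall (B : set R) (C : set nat), measurable B ->
    P ((Y @^-1` B) `&` (Z @^-1` C)) =
    \int[P]_(w in Y @^-1` B) poisson_prob (Y w) 0%N C.

Definition sample_mean (T : Type) (R : realType) (X : nat -> T -> R) (m : nat)
    (w : T) : R :=
  ((\sum_(j < m) X j w) / m%:R)%R.

(* The number N^alpha of variables; exact for N in [admissible]. *)
Definition nvars (R : realType) (alpha N : R) : nat := Num.truncn (N `^ alpha)%R.

Definition admissible (R : realType) (a alpha : R) : set R :=
  [set N | [/\ (0 < N)%R,
               exists2 k : nat, (0 < k)%N & (N * a)%R = k%:R
             & exists2 m : nat, (0 < m)%N & (N `^ alpha)%R = m%:R]].

(* dP/dP_a on (X_1, ..., X_m) *)
Definition likelihood_ratio (R : realType) (M : R -> R) (theta : R) (m : nat)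
    (x : 'I_m -> R) : R :=
  (\prod_(j < m) (M theta * expR (- theta * x j)))%R.

(* Main.v *)
(* Put r = 1 + 2 theta m / N with m = N^alpha, S = X_1 + ... + X_m and
   Y = N S / m.  On {Z >= Na} one has 1 <= r^(Z - Na), and since Z is Poisson
   with mean Y given Y, E_a[r^Z | Y] = e^((r - 1) Y) = e^(2 theta S).  This
   cancels the random part of L^2 = M^(2m) e^(- 2 theta S) exactly, so the
   second moment is at most M^(2m) r^(- Na).  As m / N -> 0,
   (Na / m) ln r -> 2 theta a, which gives the bound 2 ln M - 2 theta a; this is
   -2 I(a) because theta is the maximizer in the Legendre transform.  That
   r >= 1, i.e. theta >= 0, comes from a > nu. *)
Require Import Defs.
From mathcomp Require Import all_boot all_order all_algebra.
From mathcomp Require Import all_classical all_reals all_analysis.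
From mathcomp Require Import measurable_realfun ring lra.

Import Order.TTheory GRing.Theory Num.Theory.
Import numFieldNormedType.Exports.
Import HBNNSimple.

Local Open Scope classical_set_scope.
Local Open Scope ring_scope.
Local Open Scope ereal_scope.

(** * Conditioning on Y and the exponential tilt of a mixed Poisson variable *)

Lemma integral_nnsfun_compM {d : measure_display} {T : measurableType d}
    {R : realType} (mu : {measure set T -> \bar R}) (Y h : T -> R)
    (g : {nnsfun R >-> R}) :
  measurable_fun setT Y ->
  measurable_fun setT h -> (forall w, (0 <= h w)%R) ->
  \int[mu]_w ((g (Y w))%:E * (h w)%:E) =
  \sum_(r \in range g)
    r%:E * \int[mu]_(w in Y @^-1` (g @^-1` [set r])) (h w)%:E.
Proof.
move=> mY mh h0.
have mYg r : measurable (Y @^-1` (g @^-1` [set r])).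
  by rewrite -[X in measurable X]setTI; apply: mY.
have mind r : measurable_fun setT
    (fun w => r%:E * ((h w)%:E * (\1_(Y @^-1` (g @^-1` [set r])) w)%:E)).
  apply: emeasurable_funM => //; apply: emeasurable_funM.
    exact/measurable_EFinP.
  by apply/measurable_EFinP; exact: measurable_indic.
transitivity (\int[mu]_w \sum_(r \in range g)
    (r%:E * ((h w)%:E * (\1_(Y @^-1` (g @^-1` [set r])) w)%:E))).
  apply: eq_integral => w _; rewrite fimfunE -fsumEFin// ge0_mule_fsuml.
    by apply: eq_fsbigr => r _; rewrite EFinM -muleA (muleC (h w)%:E).
  by move=> r; exact: nnfun_muleindic_ge0.
have r_ge0 r : r \in range g -> (0 <= r)%R by rewrite inE => -[t _ <-].
have nonneg r w :
    0 <= r%:E * ((h w)%:E * (\1_(Y @^-1` (g @^-1` [set r])) w)%:E).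
  (* Nonnegativity is claimed for every real r: a negative r is not a value of [g], so its preimage
     is empty and the term is 0. *)
  have [r0|r0] := leP 0%R r.
    by rewrite !mule_ge0// lee_fin.
  rewrite (_ : _ @^-1` _ = set0) ?indic0 ?mule0//.
  by rewrite preimage_nnfun0// preimage_set0.
rewrite ge0_integral_fsum//.
apply: eq_fsbigr => r /r_ge0 r0.
rewrite ge0_integralZl_EFin//.
- congr (_ * _); rewrite [RHS]integral_mkcond.
  by apply: eq_integral => w _; rewrite epatch_indic.
- by move=> w _; rewrite mule_ge0// lee_fin.
- apply: emeasurable_funM; first exact/measurable_EFinP.
  by apply/measurable_EFinP; exact: measurable_indic.
Qed.

(** This plays the role of conditional expectation: [h1] and [h2] have equal integrals over every
    event {Y in B}, so they may be exchanged against any nonnegative function of Y. For simple [g]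
    both sides are the same finite sum; monotone convergence gives the general case. *)
Lemma eq_integral_compM {d : measure_display} {T : measurableType d}
    {R : realType} (mu : {measure set T -> \bar R}) (Y h1 h2 : T -> R)
    (g : R -> R) :
  measurable_fun setT Y ->
  measurable_fun setT h1 -> (forall w, (0 <= h1 w)%R) ->
  measurable_fun setT h2 -> (forall w, (0 <= h2 w)%R) ->
  (forall B, measurable B ->
    \int[mu]_(w in Y @^-1` B) (h1 w)%:E =
    \int[mu]_(w in Y @^-1` B) (h2 w)%:E) ->
  measurable_fun setT g -> (forall y, (0 <= g y)%R) ->
  \int[mu]_w ((g (Y w))%:E * (h1 w)%:E) = \int[mu]_w ((g (Y w))%:E * (h2 w)%:E).
Proof.
move=> mY mh1 h10 mh2 h20 h12 mg g0.
have mEg : measurable_fun setT (EFin \o g) by exact/measurable_EFinP.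
pose g_ := nnsfun_approx measurableT mEg.
have lim_approx (h : T -> R) : measurable_fun setT h ->
    (forall w, (0 <= h w)%R) -> \int[mu]_w ((g (Y w))%:E * (h w)%:E) =
      limn (fun n => \int[mu]_w ((g_ n (Y w))%:E * (h w)%:E)).
  move=> mh h0; rewrite -monotone_convergence//.
  - apply: eq_integral => w _; apply/esym/cvg_lim => //.
    apply: cvgeZr => //; apply: (cvg_nnsfun_approx measurableT mEg) => //.
    by move=> y _; rewrite lee_fin.
  - move=> n; apply: emeasurable_funM; last exact/measurable_EFinP.
    by apply/measurable_EFinP; exact: measurableT_comp.
  - by move=> n w _; rewrite mule_ge0// lee_fin.
  - move=> w _ m n mn; rewrite lee_wpmul2r ?lee_fin//.
    exact/lefP/nd_nnsfun_approx.
rewrite !lim_approx//; congr (limn _); apply/funext => n.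
rewrite !integral_nnsfun_compM//; apply: eq_fsbigr => r _; congr (_ * _).
by apply: h12; exact: measurable_funPTI.
Qed.

Lemma poisson_prob_set1 {R : realType} (y : R) (z : nat) :
  poisson_prob y 0%N [set z] =
  (if (0 < y)%R then poisson_pmf y z else (z == 0%N)%:R)%:E.
Proof.
rewrite /poisson_prob; case: ifPn => _.
  by rewrite esum_set1// lee_fin poisson_pmf_ge0.
by rewrite diracE in_set1 eq_sym.
Qed.

(** Weighting Poisson(y) by r^z and normalising by its generating function e^((r - 1) y) yields
    Poisson(r y). For y = 0 both laws are the Dirac mass at 0. *)
Lemma poisson_prob_tilt {R : realType} (r y : R) (z : nat) :
  (0 < r)%R -> (0 <= y)%R ->
  (expR (- ((r - 1) * y)) * r ^+ z)%:E * poisson_prob y 0%N [set z] =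
  poisson_prob (r * y)%R 0%N [set z].
Proof.
move=> r0; rewrite le_eqVlt => /predU1P[<-|y0]; rewrite !poisson_prob_set1.
  rewrite !mulr0 ltxx oppr0 expR0 mul1r.
  by case: eqP => [->|_]; rewrite ?expr0 ?mule0 ?mule1.
rewrite y0 mulr_gt0// -EFinM; congr EFin; rewrite /poisson_pmf y0 mulr_gt0//.
rewrite (_ : (- (r * y) = - ((r - 1) * y) + - y)%R); last by ring.
by rewrite expRD exprMn; ring.
Qed.

Lemma nneseries_poisson_prob_set1 {R : realType} (y : R) :
  \sum_(z <oo) poisson_prob y 0%N [set z] = 1.
Proof.
rewrite -(probability_setT (poisson_prob y 0%N)).
rewrite (_ : [set: nat] = \bigcup_(z in [set: nat]) [set z]); last first.
  by apply/seteqP; split => // z _; exists z.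
rewrite measure_bigcup//; first by apply: eq_eseriesl => z; rewrite in_setT.
by apply/trivIsetP => i j _ _ /eqP ij; apply/seteqP; split => // x [/= ->].
Qed.

(** This is E[r^Z | Y] = e^((r - 1) Y) in normalised form: given Y, the integrand tilts Poisson(Y)
    into Poisson(r Y), whose total mass is 1. The normalisation keeps the integral finite without
    any exponential moment of Y. *)
Lemma expectation_mixed_poisson_tilt {d : measure_display}
    {T : measurableType d} {R : realType} (P : probability T R)
    (Y : T -> R) (Z : {mfun T >-> nat}) (r : R) :
  measurable_fun setT Y ->
  mixed_poisson P Y Z -> (forall w, (0 <= Y w)%R) -> (0 < r)%R ->
  \int[P]_w (expR (- ((r - 1) * Y w)) * r ^+ Z w)%:E = 1.
Proof.
move=> mY YZ Y0 r0.
pose g z y := (expR (- ((r - 1) * y)) * r ^+ z)%R.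
have g0 z y : (0 <= g z y)%R by rewrite mulr_ge0 ?expR_ge0 ?exprn_ge0// ltW.
have mg z : measurable_fun setT (g z).
  apply: measurable_funM => //; apply: measurableT_comp => //.
  by apply: measurableT_comp => //; exact: measurable_funM.
pose p z y := fine (poisson_prob y 0%N [set z] : \bar R).
have pE z y : (p z y)%:E = poisson_prob y 0%N [set z].
  by rewrite fineK ?fin_num_measure.
have p0 z y : (0 <= p z y)%R by rewrite fine_ge0.
have mp z : measurable_fun setT (p z).
  rewrite /p; under eq_fun do rewrite poisson_prob_set1/=.
  apply: measurable_fun_ifT => //.
    exact: measurable_fun_ltr.
  exact: measurable_poisson_pmf.
have mZ z : measurable (Z @^-1` [set z]).
  by rewrite -[X in measurable X]setTI; exact: measurable_funPT.
(* Splitting over the values z of Z makes the exponent of r deterministic, so that each coefficient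
   [g z] is a function of Y alone. *)
have split w : (expR (- ((r - 1) * Y w)) * r ^+ Z w)%:E =
    \sum_(z <oo) ((g z (Y w))%:E * (\1_(Z @^-1` [set z]) w)%:E).
  rewrite (nneseriesD1 (n := Z w))//; last first.
    by move=> z _; rewrite mule_ge0// lee_fin.
  rewrite eseries0 ?adde0 => [|z _ /eqP zZ]; rewrite indicE.
    by rewrite mem_set// mule1.
  by rewrite memNset ?mule0// => /esym.
under eq_integral do rewrite split.
rewrite integral_nneseries//; last 2 first.
- move=> z; apply: emeasurable_funM; apply/measurable_EFinP.
    exact: measurableT_comp.
  exact: measurable_indic.
- by move=> z w _; rewrite mule_ge0// lee_fin.
transitivity (\sum_(z <oo) \int[P]_w ((g z (Y w))%:E * (p z (Y w))%:E)).
  apply: eq_eseriesr => z _.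
  (* The indicator of {Z = z} is replaced by its conditional probability [p z] at Y; [mixed_poisson]
     says that the two have the same integral over each {Y in B}. *)
  apply: (@eq_integral_compM _ _ _ P Y _ (p z \o Y)) => //.
  - exact: measurableT_comp.
  - by move=> w; exact: p0.
  - move=> B mB.
    have mYB : measurable (Y @^-1` B)
      by rewrite -[X in measurable X]setTI; exact: mY.
    rewrite integral_indic// setIC.
    apply: etrans (YZ _ _ mB) _.
    by apply: eq_integral => w _; rewrite /= pE.
rewrite -integral_nneseries//; last 2 first.
- move=> z; apply: emeasurable_funM; apply/measurable_EFinP;
  exact: measurableT_comp.
- by move=> z w _; rewrite mule_ge0// lee_fin.
transitivity (\int[P]_w (cst 1 w)); last first.
  by rewrite integral_cst//= mul1e; exact: probability_setT.
apply: eq_integral => w _.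
under eq_eseriesr do rewrite pE poisson_prob_tilt//.
exact: nneseries_poisson_prob_set1.
Qed.

(** * Differentiation of the moment-generating function under the integral *)

Lemma mgfE {d : measure_display} {T : measurableType d} {R : realType}
    (P : probability T R) (X : T -> R) (t : R) :
  mgf P X t = (\int[P]_w expR (X w * t))%R.
Proof. by rewrite /mgf /mmt_gen_fun unlock. Qed.

Lemma measurable_expR_scale {d : measure_display} {T : measurableType d}
    {R : realType} (X : {mfun T >-> R}) (t : R) :
  measurable_fun setT (fun w => expR (X w * t)).
Proof. by apply: measurableT_comp => //; exact: measurable_funM. Qed.

Lemma mgf_domain_integrable {d : measure_display} {T : measurableType d}
    {R : realType} (P : probability T R) (X : {mfun T >-> R}) (t : R) :
  mgf_domain P X t -> P.-integrable setT (EFin \o (fun w => expR (X w * t))).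
Proof.
rewrite /mgf_domain/= /mmt_gen_fun unlock => Mt.
apply/integrableP; split.
  by apply/measurable_EFinP; exact: measurable_expR_scale.
by under eq_integral do rewrite gee0_abs ?lee_fin ?expR_ge0//.
Qed.

Lemma is_derive_expR_scale {R : realType} (x t : R) :
  is_derive t 1%R (fun s => expR (x * s)) (x * expR (x * t))%R.
Proof.
rewrite mulrC; apply: is_derive1_comp.
rewrite -[X in is_derive _ _ _ X]mulr1.
exact: is_deriveZ.
Qed.

Section real_integrable.
Context {d : measure_display} {T : measurableType d} {R : realType}.
Variable mu : {measure set T -> \bar R}.
Local Notation mu_int f := (mu.-integrable setT (EFin \o f)).

Lemma EFin_integrableZl (k : R) (f : T -> R) :
  mu_int f -> mu_int (fun w => k * f w)%R.
Proof.
move=> intf; have := integrableZl measurableT k intf.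
by apply: eq_integrable => // w _; rewrite /= EFinM.
Qed.

Lemma EFin_integrableD (f g : T -> R) :
  mu_int f -> mu_int g -> mu_int (fun w => f w + g w)%R.
Proof.
move=> intf intg; have := integrableD measurableT intf intg.
by apply: eq_integrable => // w _; rewrite /= EFinD.
Qed.

Lemma EFin_integrableB (f g : T -> R) :
  mu_int f -> mu_int g -> mu_int (fun w => f w - g w)%R.
Proof.
move=> intf intg; have := integrableB measurableT intf intg.
by apply: eq_integrable => // w _; rewrite /= EFinB.
Qed.

End real_integrable.

Section positive_mgf.
Context {d : measure_display} {T : measurableType d} {R : realType}.
Variables (P : probability T R) (X : {mfun T >-> R}).
Hypothesis X0 : forall w, (0 <= X w)%R.

Lemma interior_mgf_domain_gt (t : R) : (mgf_domain P X)° t ->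
  exists2 v, (t < v)%R & mgf_domain P X v.
Proof.
move=> /nbhs_ballP[e /= e0 te]; exists (t + e / 2)%R; first by lra.
by apply: te; rewrite /ball/= opprD addNKr normrN gtr0_norm; lra.
Qed.

Lemma mgf_domain_le (s t : R) : (s <= t)%R ->
  mgf_domain P X t -> mgf_domain P X s.
Proof.
rewrite /mgf_domain/= /mmt_gen_fun unlock => st; apply: le_lt_trans.
apply: ge0_le_integral => //.
- by move=> w _; rewrite lee_fin expR_ge0.
- by apply/measurable_EFinP; exact: measurable_expR_scale.
- by apply/measurable_EFinP; exact: measurable_expR_scale.
- by move=> w _; rewrite lee_fin ler_expR ler_wpM2l.
Qed.

(** The factor x is absorbed by (v' - v) x <= e^((v' - v) x). The bound is uniform in s <= v, hence
    serves as the dominating function for the derivative. *)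
Lemma scale_expR_le (x s v v' : R) : (0 <= x)%R -> (s <= v)%R -> (v < v')%R ->
  (x * expR (x * s) <= (v' - v)^-1 * expR (x * v'))%R.
Proof.
move=> x0 sv vv'; rewrite ler_pdivlMl ?subr_gt0// mulrA.
rewrite (_ : x * v' = x * (v' - v) + x * v)%R; last by ring.
rewrite expRD ler_pM ?expR_ge0 ?mulr_ge0 ?subr_ge0 ?(ltW vv')//.
  rewrite mulrC (le_trans _ (expR_ge1Dx _))//; lra.
by rewrite ler_expR ler_wpM2l.
Qed.

Lemma derive1_mgf (t : R) : (mgf_domain P X)° t ->
  derive1 (mgf P X) t = (\int[P]_w (X w * expR (X w * t)))%R /\
  P.-integrable setT (EFin \o (fun w => X w * expR (X w * t))%R).
Proof.
move=> /interior_mgf_domain_gt[v' tv' Mv'].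
(* The midpoint leaves room on both sides: t is interior to (t - 1, v), and the gap v' - v pays for
   the factor X. To the left of v' the generating function is finite because X >= 0. *)
pose v := ((t + v') / 2)%R.
have tv : (t < v)%R by rewrite /v; lra.
have vv' : (v < v')%R by rewrite /v; lra.
have df x s : partial1of2 (fun s w => expR (X w * s)) s x =
    (X x * expR (X x * s))%R.
  by rewrite partial1of2E; apply: derive_val; exact: is_derive_expR_scale.
have intG : P.-integrable setT
      (EFin \o (fun w => (v' - v)^-1 * expR (X w * v'))%R).
  by apply: EFin_integrableZl; exact: mgf_domain_integrable.
split.
  rewrite (_ : mgf P X = fun s => (\int[P]_w expR (X w * s))%R); last first.
    by apply/funext => s; exact: mgfE.
  rewrite (@differentiation_under_integral _ _ _ P (fun s w => expR (X w * s))
    _ measurableT t (t - 1)%R v _ _ _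
    (fun w => (v' - v)^-1 * expR (X w * v'))%R)//.
  - by apply: eq_Rintegral => w _; exact: df.
  - by rewrite /= in_itv/= tv andbT; lra.
  - move=> s /=; rewrite in_itv/= => /andP[_ sv].
    apply: mgf_domain_integrable; apply: mgf_domain_le Mv'.
    by rewrite ltW// (lt_trans sv).
  - by move=> w; rewrite mulr_ge0 ?expR_ge0// invr_ge0 subr_ge0 ltW.
  - move=> s w /=; rewrite in_itv/= => /andP[_ sv] _.
    by rewrite df ger0_norm ?mulr_ge0 ?expR_ge0// scale_expR_le// ltW.
apply: (le_integrable _ _ _ intG) => //.
  apply/measurable_EFinP; apply: measurable_funM => //.
  exact: measurable_expR_scale.
move=> w _ /=; rewrite lee_fin ger0_norm ?mulr_ge0 ?expR_ge0//.
rewrite ger0_norm ?mulr_ge0 ?expR_ge0 ?invr_ge0 ?subr_ge0 ?(ltW vv')//.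
by rewrite scale_expR_le// ltW.
Qed.

(** * The saddle point theta: its sign, and the value of the rate function *)

Variables (nu a theta : R).
Hypothesis hmean : 'E_P[X] = nu%:E.
Hypothesis nua : (nu < a)%R.
Hypothesis htheta_dom : (mgf_domain P X)° theta.
Hypothesis htheta : (derive1 (mgf P X) theta / mgf P X theta)%R = a.

Let U w := expR (X w * theta).
Let V w := (X w * expR (X w * theta))%R.

Let nu_ge0 : (0 <= nu)%R.
Proof. by rewrite -lee_fin -hmean expectation_ge0. Qed.

Lemma mgf_saddle_gt0 : (0 < mgf P X theta)%R.
Proof.
rewrite lt0r {2}mgfE Rintegral_ge0 ?andbT => [|w _]; last exact: expR_ge0.
(* Since the inverse of 0 is 0, M(theta) = 0 would turn the saddle-point equation into a = 0,
   against a > nu >= 0. *)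
apply/eqP => M0; move: nua; rewrite -htheta M0 invr0 mulr0.
by rewrite ltNge nu_ge0.
Qed.

Let intU : P.-integrable setT (EFin \o U).
Proof. by apply: mgf_domain_integrable; exact: interior_subset htheta_dom. Qed.

Let intV : P.-integrable setT (EFin \o V).
Proof. by have [] := derive1_mgf theta htheta_dom. Qed.

(** The saddle-point equation with its denominator cleared: the twisted mean is a. *)
Let RintV : (\int[P]_w V w = a * \int[P]_w U w)%R.
Proof.
have [<- _] := derive1_mgf theta htheta_dom.
by rewrite -mgfE -htheta mulfVK// gt_eqF// mgf_saddle_gt0.
Qed.

(* The exponential twist decreases the mean when theta <= 0, because
   (X - nu) (e^{theta X} - e^{theta nu}) <= 0, but the twisted mean is
   a > nu. *)
Lemma saddle_ge0 : (0 <= theta)%R.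
Proof.
rewrite leNgt; apply/negP => theta0.
have intX : P.-integrable setT (EFin \o X).
  apply/integrableP; split; first exact/measurable_EFinP.
  under eq_integral do rewrite /= ger0_norm//.
  by move: hmean; rewrite unlock => ->; rewrite ltry.
have RintX : (\int[P]_w X w = nu)%R.
  by rewrite /Rintegral; move: hmean; rewrite unlock => ->.
pose c := expR (nu * theta).
have int1 : P.-integrable setT (EFin \o cst nu).
  exact: finite_measure_integrable_cst.
have intL : P.-integrable setT (EFin \o (fun w => V w - nu * U w)%R).
  by apply: EFin_integrableB => //; exact: EFin_integrableZl.
have intR : P.-integrable setT (EFin \o (fun w => c * (X w - nu))%R).
  by apply: EFin_integrableZl; exact: EFin_integrableB.
have : (\int[P]_w (V w - nu * U w) <= \int[P]_w (c * (X w - nu)))%R.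
  apply: le_Rintegral => // w _.
  rewrite -subr_ge0 (_ : _ - _ = (X w - nu) * (c - U w))%R; last first.
    by rewrite /V /U; ring.
  have [Xnu|nuX] := leP (X w) nu.
    by rewrite mulr_le0// subr_le0// ler_expR ler_wnM2r// ltW.
  by rewrite mulr_ge0// subr_ge0 ?(ltW nuX)// ler_expR ler_wnM2r// ltW.
rewrite RintegralB//; last exact: EFin_integrableZl.
rewrite !RintegralZl//; last exact: EFin_integrableB.
have Rint_nu : (\int[P]_w cst nu w = nu)%R.
  by rewrite Rintegral_cst//= [X in fine X]probability_setT mulr1.
rewrite RintegralB// Rint_nu RintX subrr mulr0.
rewrite RintV -mulrBl -mgfE leNgt mulr_gt0 ?mgf_saddle_gt0//.
by rewrite subr_gt0.
Qed.

(* Integrates the tangent-line bound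
   e^{xt} >= e^{a (t - theta)} e^{x theta} (1 + (x - a)(t - theta)). *)
Lemma mgf_ge_tangent (t : R) : mgf_domain P X t ->
  (expR (a * (t - theta)) * mgf P X theta <= mgf P X t)%R.
Proof.
move=> Mt; pose c := expR (a * (t - theta)).
(* With this [b], the combination b U + (t - theta) V equals U (1 + (X - a)(t - theta)). It
   integrates to M(theta), because b + a (t - theta) = 1. *)
pose b := (1 - a * (t - theta))%R.
have intL : P.-integrable setT
    (EFin \o (fun w => b * U w + (t - theta) * V w)%R).
  by apply: EFin_integrableD; exact: EFin_integrableZl.
have -> : (c * mgf P X theta = \int[P]_w (c * (b * U w + (t - theta) * V w)))%R.
  rewrite RintegralZl// RintegralD//; last 2 first.
  - exact: EFin_integrableZl.
  - exact: EFin_integrableZl.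
  by rewrite !RintegralZl// RintV -mgfE /b; ring.
rewrite mgfE; apply: le_Rintegral => //.
- exact: EFin_integrableZl.
- exact: mgf_domain_integrable.
move=> w _.
rewrite (_ : X w * t =
  a * (t - theta) + X w * theta + (X w - a) * (t - theta))%R; last by ring.
rewrite 2!expRD -mulrA ler_pM2l ?expR_gt0//.
rewrite (_ : b * U w + _ = U w * (1 + (X w - a) * (t - theta)))%R; last first.
  by rewrite /b /V /U; ring.
by rewrite ler_pM2l ?expR_gt0// expR_ge1Dx.
Qed.

(** Taking logarithms in the tangent bound shows that no t beats theta in the Legendre transform. An
    upper bound on I is the required direction, as the target is -2 I(a). *)
Lemma rate_function_le_saddle :
  rate_function P X a <= (theta * a - ln (mgf P X theta))%:E.
Proof.
apply: ge_ereal_sup => _ [t _ <-].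
have [Mt|] := ltP ('M_P X t) +oo; last first.
  by rewrite leye_eq => /eqP ->; exact: leNye.
have M0 := mgf_saddle_gt0.
have tangent := mgf_ge_tangent t Mt.
have Mt0 : (0 < mgf P X t)%R.
  by rewrite (lt_le_trans _ tangent)// mulr_gt0 ?expR_gt0.
have -> : 'M_P X t = (mgf P X t)%:E.
  rewrite fineK// ge0_fin_numE//.
  by apply: expectation_ge0 => w; exact: expR_ge0.
rewrite lne_EFin// -EFinB lee_fin.
move: tangent; rewrite -ler_ln ?posrE ?mulr_gt0 ?expR_gt0//.
rewrite lnM ?posrE ?expR_gt0// expRK; lra.
Qed.

End positive_mgf.

(** * Bound on the second moment for a fixed N *)

Lemma likelihood_ratioE {R : realType} (M : R -> R) (theta : R) (m : nat)
    (x : 'I_m -> R) :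
  likelihood_ratio M theta x =
  (M theta ^+ m * expR (- theta * \sum_(j < m) x j))%R.
Proof.
rewrite /likelihood_ratio big_split/= prodr_const card_ord; congr (_ * _)%R.
by rewrite -expR_sum -mulr_sumr.
Qed.

Lemma measurable_sample_mean {d : measure_display} {T : measurableType d}
    {R : realType} (X : nat -> {mfun T >-> R}) (m : nat) :
  measurable_fun setT (sample_mean X m).
Proof.
apply: measurable_funM => //; apply: measurable_sum => j.
exact: measurable_funPT.
Qed.

Lemma second_moment_le {d : measure_display} {T : measurableType d}
    {R : realType} (P : probability T R) (X : nat -> {mfun T >-> R})
    (Z : {mfun T >-> nat}) (M : R -> R) (theta N : R) (m k : nat) :
  (forall i w, (0 <= X i w)%R) -> (0 <= theta)%R -> (0 < N)%R -> (0 < m)%N ->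
  mixed_poisson P (fun w => N * sample_mean X m w)%R Z ->
  'E_P[fun w => ((likelihood_ratio M theta (fun j : 'I_m => X j w)
    * (k%:R <= (Z w)%:R :> R)%R%:R) ^+ 2)%R] <=
  (M theta ^+ m ^+ 2 / (1 + 2 * theta * m%:R / N) ^+ k)%:E.
Proof.
move=> X0 theta0 N0 m0 YZ; set r := (1 + _)%R.
pose Y w := (N * sample_mean X m w)%R.
have m0' : (0 < m%:R :> R)%R by rewrite ltr0n.
have r1 : (1 <= r)%R by rewrite lerDl divr_ge0 ?mulr_ge0// ltW.
have r0 : (0 < r)%R by rewrite (lt_le_trans _ r1).
have Y0 w : (0 <= Y w)%R.
  by rewrite mulr_ge0 ?(ltW N0)// divr_ge0// sumr_ge0.
have mY : measurable_fun setT Y.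
  by apply: measurable_funM => //; exact: measurable_sample_mean.
have mind : measurable_fun setT (fun w => (k%:R <= (Z w)%:R :> R)%R%:R : R).
  have : measurable_fun [set: nat]
    (fun z => (k%:R <= z%:R :> R)%R%:R : R) by [].
  by move=> /measurableT_comp; apply; exact: measurable_funPT.
have mZ : measurable_fun setT (fun w => r ^+ Z w)%R.
  have : measurable_fun [set: nat] (fun z => r ^+ z)%R by [].
  by move=> /measurableT_comp; apply; exact: measurable_funPT.
(* The choice of r gives (r - 1) Y = 2 theta S, so squaring L produces exactly the normalising
   factor e^(-(r - 1) Y) of the Poisson tilt. *)
have LE w : likelihood_ratio M theta (fun j : 'I_m => X j w) =
    (M theta ^+ m * expR (- (r - 1) * Y w / 2))%R.
  rewrite likelihood_ratioE; congr (_ * expR _)%R.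
  by rewrite /Y /sample_mean /r; field; rewrite !gt_eqF.
under [in leLHS]eq_fun do rewrite LE.
set c := (_ / _)%R.
have c0 : (0 <= c)%R by rewrite divr_ge0 ?sqr_ge0 ?exprn_ge0// ltW.
have mexp s : measurable_fun setT (fun w => expR (s * Y w)).
  by apply: measurableT_comp => //; exact: measurable_funM.
rewrite unlock.
apply: (@le_trans _ _ (\int[P]_w (c%:E *
    (expR (- ((r - 1) * Y w)) * r ^+ Z w)%:E))); last first.
  rewrite ge0_integralZl_EFin//; last 2 first.
  - by move=> w _; rewrite lee_fin mulr_ge0 ?expR_ge0 ?exprn_ge0// ltW.
  - apply/measurable_EFinP; apply: measurable_funM => //.
    by under eq_fun do rewrite -mulNr; exact: mexp.
  by rewrite (expectation_mixed_poisson_tilt P Y Z r)// mule1.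
apply: ge0_le_integral => //.
- by move=> w _; rewrite lee_fin sqr_ge0.
- apply/measurable_EFinP; apply: measurable_funX; apply: measurable_funM => //.
  apply: measurable_funM => //; under eq_fun do rewrite mulrAC.
  exact: mexp.
- under eq_fun do rewrite -EFinM.
  apply/measurable_EFinP; apply: measurable_funM => //.
  apply: measurable_funM => //.
  by under eq_fun do rewrite -mulNr; exact: mexp.
move=> w _; rewrite -EFinM lee_fin ler_nat.
have rhs0 : (0 <= c * (expR (- ((r - 1) * Y w)) * r ^+ Z w))%R.
  by rewrite mulr_ge0// mulr_ge0 ?expR_ge0// exprn_ge0// ltW.
(* Off {Z >= k} the left side is 0. On it the exponential factors agree, and r^k <= r^Z because r >=
   1. *)
case: leqP => kZ; last by rewrite mulr0 expr0n.
rewrite mulr1 exprMn -expRM_natl.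
rewrite (_ : _ * (_ / 2) = - ((r - 1) * Y w))%R; last by field.
rewrite /c -[leRHS]mulrA ler_wpM2l ?sqr_ge0// ler_pdivlMl ?exprn_gt0// mulrC.
by rewrite ler_wpM2l ?expR_ge0// ler_weXn2l.
Qed.

(** * Logarithmic asymptotics with an explicit error of order m / N *)

Lemma ln1Dx_ge {R : realType} (x : R) :
  (0 <= x)%R -> (x - x ^+ 2 <= ln (1 + x))%R.
Proof.
move=> x0; have r0 : (0 < 1 + x)%R by lra.
(* The bound ln (1 + u) <= u at u = 1/(1 + x) - 1 gives ln (1 + x) >= x/(1 + x), which exceeds x -
   x^2 by x^3/(1 + x). *)
have : (ln (1 + ((1 + x)^-1 - 1)) <= (1 + x)^-1 - 1)%R.
  by apply: le_ln1Dx; rewrite ltrBrDl subrr invr_gt0.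
rewrite (_ : 1 + ((1 + x)^-1 - 1) = (1 + x)^-1)%R; last by ring.
rewrite lnV ?posrE// => lnx.
apply: (@le_trans _ _ (1 - (1 + x)^-1)%R); last by lra.
rewrite -subr_ge0 (_ : _ - _ = x ^+ 3 / (1 + x))%R; last by field; lra.
by rewrite divr_ge0 ?exprn_ge0// ltW.
Qed.

(** For x = 2 theta m / N, the prefactor N a / m turns the term x of the bound x - x^2 into 2 theta
    a and the term x^2 into the error 4 theta^2 a m / N. *)
Lemma ln_second_moment_le {R : realType} (M theta a N : R) (m k : nat) :
  (0 < M)%R -> (0 <= theta)%R -> (0 < N)%R -> (0 < m)%N -> (N * a)%R = k%:R ->
  (m%:R^-1 * ln (M ^+ m ^+ 2 / (1 + 2 * theta * m%:R / N) ^+ k) <=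
   - (2 * (theta * a - ln M)) + 4 * theta ^+ 2 * a * (m%:R / N))%R.
Proof.
move=> M0 theta0 N0 m0 Na; set x := (2 * theta * m%:R / N)%R.
have m0' : (0 < m%:R :> R)%R by rewrite ltr0n.
have x0 : (0 <= x)%R by rewrite divr_ge0 ?mulr_ge0// ltW.
have r0 : (0 < 1 + x)%R by lra.
rewrite ln_div ?posrE ?exprn_gt0// !lnXn ?exprn_gt0//.
rewrite -[(_ *+ k)%R]mulr_natr -Na.
rewrite -[(ln M *+ m *+ 2)%R]mulr_natr -[(ln M *+ m)%R]mulr_natr.
have a0 : (0 <= a)%R by rewrite -(pmulr_rge0 _ N0) Na.
have -> : (m%:R^-1 * (ln M * m%:R * 2 - ln (1 + x) * (N * a)) =
    2 * ln M - N * a / m%:R * ln (1 + x))%R by field; rewrite gt_eqF.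
have c0 : (0 <= N * a / m%:R)%R by rewrite divr_ge0// mulr_ge0// ltW.
have := ler_wpM2l c0 (ln1Dx_ge x x0).
rewrite (_ : N * a / m%:R * (x - x ^+ 2) =
    2 * theta * a - 4 * theta ^+ 2 * a * (m%:R / N))%R; first by lra.
by rewrite /x; field; rewrite !gt_eqF.
Qed.

Lemma near_powR_div_le {R : realType} (alpha K e : R) :
  (alpha < 1)%R -> (0 <= K)%R -> (0 < e)%R ->
  \forall N \near +oo%R, (K * (N `^ alpha / N) <= e)%R.
Proof.
move=> alpha1 K0 e0; near=> N.
have N0 : (0 < N)%R by near: N; exact: nbhs_pinfty_gt.
(* The threshold solves K N^(alpha - 1) = e for N, which is possible because alpha < 1. *)
have NK : ((K / e) `^ (1 - alpha)^-1 <= N)%R by near: N; exact: nbhs_pinfty_ge.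
have Ke0 : (0 <= K / e)%R by rewrite divr_ge0// ltW.
have : (K / e <= N `^ (1 - alpha))%R.
  have a1 : (1 - alpha != 0)%R by lra.
  have -> : (K / e = ((K / e) `^ (1 - alpha)^-1) `^ (1 - alpha))%R.
    by rewrite -powRrM mulVf// powRr1.
  by rewrite ge0_ler_powR ?nnegrE ?powR_ge0//; lra.
rewrite ler_pdivrMr// => KN.
rewrite mulrA ler_pdivrMr// (le_trans (ler_wpM2r (powR_ge0 _ _) KN))//.
rewrite mulrAC -powRD ?subrK ?powRr1 ?(ltW N0)// 1?mulrC//.
by rewrite (gt_eqF N0) implybT.
Unshelve. all: by end_near. Qed.

(** * Passage to the limit superior along the admissible N *)

Theorem proposition4p2 (R : realType) (d : measure_display)
  (T : measurableType d) (P Pa : probability T R)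
  (X : nat -> {mfun T >-> R}) (Z : R -> {mfun T >-> nat})
  (alpha nu a theta : R)
  (halpha : (0 < alpha < 1)%R)
  (hXge0 : forall (i : nat) (w : T), (0 <= X i w)%R)
  (hXiid : iid_with_law P X (distribution P (X 0%N)))
  (hmean : 'E_P[X 0%N] = nu%:E)
  (hmgf : (mgf_domain P (X 0%N))° 0%R)
  (ha : (nu < a)%R)
  (hb : a%:E <= right_endpoint P (X 0%N))
  (htheta_dom : (mgf_domain P (X 0%N))° theta)
  (htheta : (derive1 (mgf P (X 0%N)) theta / mgf P (X 0%N) theta)%R = a)
  (hXiid_a : iid_with_law Pa X (twisted_law P (X 0%N) theta))
  (hZ : forall N : R, admissible a alpha N ->
    mixed_poisson P
      (fun w => N * sample_mean X (nvars alpha N) w)%R (Z N))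
  (hZ_a : forall N : R, admissible a alpha N ->
    mixed_poisson Pa
      (fun w => N * sample_mean X (nvars alpha N) w)%R (Z N)) :
  limf_esup
    (fun N : R => ((N `^ alpha)^-1)%R%:E *
      lne 'E_Pa[fun w =>
        ((likelihood_ratio (mgf P (X 0%N)) theta
            (fun j : 'I_(nvars alpha N) => X j w)
          * (N * a <= (Z N w)%:R)%R%:R) ^+ 2)%R])
    (within (admissible a alpha) +oo%R)
  <= - (2%:E * rate_function P (X 0%N) a).
Proof.
have X00 := hXge0 0%N.
have theta0 := saddle_ge0 P (X 0%N) X00 nu a theta hmean ha htheta_dom htheta.
have M0 := mgf_saddle_gt0 P (X 0%N) X00 nu a theta hmean ha htheta.
have I_le := rate_function_le_saddle P (X 0%N) X00 nu a theta
  hmean ha htheta_dom htheta.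
have a0 : (0 <= a)%R.
  by rewrite (le_trans _ (ltW ha))// -lee_fin -hmean expectation_ge0.
set M := mgf P (X 0%N) theta in M0 I_le.
apply: (@le_trans _ _ (- (2 * (theta * a - ln M)))%:E); last first.
  by rewrite EFinN leeN2 EFinM lee_pmul2l.
(* The limit superior is an infimum of suprema over the sets of the filter. For each e > 0 it thus
   suffices to exhibit one such set where the bound holds up to e: the admissible N whose error term
   is at most e. *)
apply/lee_addgt0Pr => e e0; apply: ge_ereal_inf.
have K0 : (0 <= 4 * theta ^+ 2 * a)%R by rewrite !mulr_ge0// sqr_ge0.
have alpha1 : (alpha < 1)%R by case/andP: halpha.
exists (ereal_sup
  ((fun N : R => ((N `^ alpha)^-1)%R%:E *
      lne 'E_Pa[fun w =>
        ((likelihood_ratio (mgf P (X 0%N)) theta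
            (fun j : 'I_(nvars alpha N) => X j w)
          * (N * a <= (Z N w)%:R)%R%:R) ^+ 2)%R])
    @` [set N | admissible a alpha N /\
         (4 * theta ^+ 2 * a * (N `^ alpha / N) <= e)%R])).
  eexists; last by [].
  have := near_powR_div_le alpha _ e alpha1 K0 e0.
  rewrite /= /within/=; apply: filterS => N KN admN; split => //.
apply: ge_ereal_sup => _ [N [admN KN] <-].
have [N0 [k k0 Nk] [m m0 Nm]] := admN.
have := second_moment_le Pa X (Z N) (mgf P (X 0%N)) theta N m k
  hXge0 theta0 N0 m0.
(* On admissible N the power N^alpha is the integer m, so the truncation in [nvars] is exact. *)
have := hZ_a N admN; rewrite /nvars Nm natrK => hZN /(_ hZN).
rewrite -Nk -/M => moment_le.
set c := (_ / _)%R in moment_le.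
have c0 : (0 < c)%R.
  rewrite divr_gt0 ?exprn_gt0// ltr_wpDr//.
  by rewrite divr_ge0 ?mulr_ge0// ltW.
apply: (@le_trans _ _ (m%:R^-1 * ln c)%:E).
  rewrite EFinM lee_pmul2l ?lte_fin ?invr_gt0 ?ltr0n// -lne_EFin//.
  (* Monotonicity of [lne] holds on all of [0, +oo], so nonnegativity of the second moment is
     enough. *)
  rewrite lee_lne// in_itv/= leey andbT ?lee_fin ?(ltW c0)//.
  by apply: expectation_ge0 => w; exact: sqr_ge0.
rewrite -EFinD lee_fin.
apply: le_trans (ln_second_moment_le M theta a N m k M0 theta0 N0 m0 Nk) _.
by rewrite lerD2l -Nm.
Qed.
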